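(* Let $d\geq 2$. The Hurwitz element $h_{d,[\frac d2]}$ is a stabilizing element of $\Sigma_d$: for any $s_1,s_2\in\Sigma_d$ with $\tau(s_1)=\tau(s_2)$ and $\alpha(s_1)=\alpha(s_2)$ one has $h_{d,[\frac d2]}\cdot s_1=h_{d,[\frac d2]}\cdot s_2$. Consequently the semigroup $\Sigma_d$ is stable, i.e. it possesses a stabilizing element.
   Context: $\mathcal S_d$ is the symmetric group on $\{1,\dots,d\}$. $\Sigma_d$ is the semigroup with unit generated by letters $x_\sigma$, $\sigma\in\mathcal S_d$, subject to $x_{\sigma_1}\cdot x_{\sigma_2}=x_{\sigma_2}\cdot x_{\sigma_2^{-1}\sigma_1\sigma_2}$ and $x_{\sigma_1}\cdot x_{\sigma_2}=x_{\sigma_1\sigma_2\sigma_1^{-1}}\cdot x_{\sigma_1}$, with $x_{\mathbf 1}$ equal to the unit. $\alpha:\Sigma_d\to\mathcal S_d$ is the homomorphism $x_\sigma\mapsto\sigma$. The type $\tau(s)$ of $s=x_{\sigma_1}\cdot\ldots\cdot x_{\sigma_n}$ (all $\sigma_i\ne\mathbf 1$) is the function assigning to each non-identity conjugacy class of $\mathcal S_d$ the number of indices $i$ such that $\sigma_i$ lies in that class; it depends only on $s$. The Hurwitz element of genus $g$ is $h_{d,g}=x_{(1,2)}^{2(g+1)}\cdot x_{(2,3)}^2\cdot\ldots\cdot x_{(d-1,d)}^2$. $[a]$ denotes the integer part of $a$. *)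

(* Defs.v *)
From HB Require Import structures.
From mathcomp Require Import all_boot all_fingroup.
(* generic_quotient comes last so that repr is not the one of fingroup.         *)
From mathcomp Require Import boolp generic_quotient.

Set Implicit Arguments.
Unset Strict Implicit.
Unset Printing Implicit Defensive.

Local Open Scope group_scope.
Local Open Scope quotient_scope.

(* Products in 'S_d are MathComp's: (s * t) x = t (s x).  The opposite         *)
(* convention gives an isomorphic semigroup, through x_s |-> x_(s^-1), with    *)
(* the same Hurwitz elements.                                                  *)

Inductive fact_cong (d : nat) : seq 'S_d -> seq 'S_d -> Prop :=
  | fact_cong_refl u : fact_cong u u
  | fact_cong_sym u v : fact_cong u v -> fact_cong v u
  | fact_cong_trans u v w : fact_cong u v -> fact_cong v w -> fact_cong u w
  | fact_cong_cat u u' v v' :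
      fact_cong u u' -> fact_cong v v' -> fact_cong (u ++ v) (u' ++ v')
  | fact_cong_conjr s1 s2 :
      fact_cong [:: s1; s2] [:: s2; s2^-1 * s1 * s2]
  | fact_cong_conjl s1 s2 :
      fact_cong [:: s1; s2] [:: s1 * s2 * s1^-1; s1]
  | fact_cong_one : fact_cong [:: 1] [::].

Definition fact_rel (d : nat) : rel (seq 'S_d) := fun u v => `[< fact_cong u v >].

Lemma fact_rel_refl (d : nat) : reflexive (@fact_rel d).
Proof. by move=> u; apply/asboolP; exact: fact_cong_refl. Qed.

Lemma fact_rel_sym (d : nat) : symmetric (@fact_rel d).
Proof.
by move=> u v; apply/idP/idP => /asboolP H; apply/asboolP; exact: fact_cong_sym.
Qed.

Lemma fact_rel_trans (d : nat) : transitive (@fact_rel d).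
Proof.
move=> v u w /asboolP H1 /asboolP H2; apply/asboolP; exact: fact_cong_trans H2.
Qed.

Canonical fact_equiv (d : nat) : equiv_rel (seq 'S_d) :=
  EquivRel (@fact_rel d)
    (@fact_rel_refl d) (@fact_rel_sym d) (@fact_rel_trans d).

Definition Sigma (d : nat) : Type := {eq_quot (@fact_equiv d)}.

HB.instance Definition _ (d : nat) := Choice.on (Sigma d).
HB.instance Definition _ (d : nat) := EqQuotient.on (Sigma d).

Lemma Sigma_eqP (d : nat) (u v : seq 'S_d) :
  \pi_(Sigma d) u = \pi_(Sigma d) v <-> fact_cong u v.
Proof.
split=> [/eqmodP/asboolP //|H]; apply/eqmodP; exact/asboolP.
Qed.

Lemma fact_cong_repr (d : nat) (u : seq 'S_d) :
  fact_cong (repr (\pi_(Sigma d) u)) u.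
Proof. by apply/Sigma_eqP; rewrite reprK. Qed.

Definition Sigma_mul (d : nat) (a b : Sigma d) : Sigma d :=
  \pi_(Sigma d) (repr a ++ repr b).

Definition Sigma_one (d : nat) : Sigma d := \pi_(Sigma d) [::].

Lemma Sigma_mul_pi (d : nat) (u v : seq 'S_d) :
  Sigma_mul (\pi_(Sigma d) u) (\pi_(Sigma d) v) = \pi_(Sigma d) (u ++ v).
Proof. apply/Sigma_eqP; apply: fact_cong_cat; exact: fact_cong_repr. Qed.

Lemma Sigma_mulA (d : nat) : associative (@Sigma_mul d).
Proof.
move=> a b c; rewrite -[a]reprK -[b]reprK -[c]reprK.
by rewrite !Sigma_mul_pi !reprK catA.
Qed.

Lemma Sigma_mul1s (d : nat) : left_id (Sigma_one d) (@Sigma_mul d).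
Proof. by move=> a; rewrite -[a]reprK Sigma_mul_pi. Qed.

Lemma Sigma_muls1 (d : nat) : right_id (Sigma_one d) (@Sigma_mul d).
Proof. by move=> a; rewrite -[a]reprK Sigma_mul_pi cats0. Qed.

HB.instance Definition _ (d : nat) :=
  isMonoid.Build (Sigma d) (@Sigma_mulA d) (@Sigma_mul1s d) (@Sigma_muls1 d).

Lemma Sigma_mulE (d : nat) (u v : seq 'S_d) :
  \pi_(Sigma d) u * \pi_(Sigma d) v = \pi_(Sigma d) (u ++ v).
Proof. exact: Sigma_mul_pi. Qed.

Definition x_ (d : nat) (s : 'S_d) : Sigma d := \pi_(Sigma d) [:: s].

Lemma Sigma_conjr (d : nat) (s1 s2 : 'S_d) :
  x_ s1 * x_ s2 = x_ s2 * x_ (s2^-1 * s1 * s2).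
Proof.
rewrite !Sigma_mulE; apply/Sigma_eqP; exact: fact_cong_conjr.
Qed.

Lemma Sigma_conjl (d : nat) (s1 s2 : 'S_d) :
  x_ s1 * x_ s2 = x_ (s1 * s2 * s1^-1) * x_ s1.
Proof.
rewrite !Sigma_mulE; apply/Sigma_eqP; exact: fact_cong_conjl.
Qed.

Lemma x_1 (d : nat) : x_ (1 : 'S_d) = 1.
Proof. apply/Sigma_eqP; exact: fact_cong_one. Qed.

Lemma Sigma_prod (d : nat) (w : seq 'S_d) :
  \prod_(s <- w) x_ s = \pi_(Sigma d) w.
Proof.
elim: w => [|s w IHw]; first by rewrite big_nil.
by rewrite big_cons IHw Sigma_mulE.
Qed.

Definition alpha (d : nat) (s : Sigma d) : 'S_d := \prod_(t <- repr s) t.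

Lemma fact_cong_prod (d : nat) (u v : seq 'S_d) :
  fact_cong u v -> \prod_(t <- u) t = \prod_(t <- v) t.
Proof.
elim=> //.
- by move=> {}u {}v w _ -> _ ->.
- by move=> u1 u2 v1 v2 _ IHu _ IHv; rewrite !big_cat /= IHu IHv.
- by move=> s1 s2; rewrite !big_cons !big_nil !mulg1 !mulgA mulgV mul1g.
- by move=> s1 s2; rewrite !big_cons !big_nil !mulg1 mulgKV.
- by rewrite big_cons !big_nil mulg1.
Qed.

Lemma alpha_pi (d : nat) (w : seq 'S_d) :
  alpha (\pi_(Sigma d) w) = \prod_(t <- w) t.
Proof. exact/fact_cong_prod/fact_cong_repr. Qed.

Lemma alpha_x (d : nat) (s : 'S_d) : alpha (x_ s) = s.
Proof. by rewrite alpha_pi big_seq1. Qed.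

Lemma alpha_monoid_morphism (d : nat) : monoid_morphism (@alpha d).
Proof.
split=> [|a b]; first by rewrite alpha_pi big_nil.
by rewrite -[a]reprK -[b]reprK Sigma_mulE !alpha_pi big_cat.
Qed.

HB.instance Definition _ (d : nat) :=
  isUMagmaMorphism.Build (Sigma d) 'S_d (@alpha d) (@alpha_monoid_morphism d).

Definition nonid_class (d : nat) : finType :=
  {C : {set 'S_d} | C \in classes [set: 'S_d] :\ [set 1]}.

(* A representative word may contain the identity; it lies in none of the      *)
(* classes ranged over, so such letters are not counted (see tau_pi).          *)
Definition tau (d : nat) (s : Sigma d) : {ffun nonid_class d -> nat} :=
  [ffun C : nonid_class d => count (fun t => t \in sval C) (repr s)].

Lemma mem_classJ (d : nat) (C : nonid_class d) (s t : 'S_d) :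
  (s ^ t \in sval C) = (s \in sval C).
Proof.
case: C => C /=; rewrite !inE => /andP[_ /imsetP[x _ ->]].
by rewrite ![_ \in x ^: _]class_sym classGidl ?inE.
Qed.

Lemma nonid_class1 (d : nat) (C : nonid_class d) : (1 \in sval C) = false.
Proof.
case: C => C /=; rewrite !inE => /andP[+ /imsetP[x _ defC]].
apply: contraNF => C1; move: C1; rewrite defC => /class_eqP <-.
by rewrite class1G.
Qed.

Lemma fact_cong_count (d : nat) (C : nonid_class d) (u v : seq 'S_d) :
  fact_cong u v ->
  count (fun t => t \in sval C) u = count (fun t => t \in sval C) v.
Proof.
elim=> //.
- by move=> {}u {}v w _ -> _ ->.
- by move=> u1 u2 v1 v2 _ IHu _ IHv; rewrite !count_cat IHu IHv.
- by move=> s1 s2 /=; rewrite -mulgA mem_classJ !addn0 addnC.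
- move=> s1 s2 /=; rewrite -{2}[s1]invgK -mulgA.
  have -> : s1^-1^-1 * (s2 * s1^-1) = s2 ^ s1^-1 by [].
  by rewrite mem_classJ !addn0 addnC.
- by rewrite /= nonid_class1.
Qed.

Lemma tau_pi (d : nat) (w : seq 'S_d) (C : nonid_class d) :
  tau (\pi_(Sigma d) w) C = count (fun t => t \in sval C) w.
Proof. rewrite ffunE; exact/fact_cong_count/fact_cong_repr. Qed.

Lemma adj_ltn (d : nat) (i : 'I_d.-1) : i.+1 < d.
Proof. by case: d i => [[]|d i] //=; rewrite ltnS ltn_ord. Qed.

(* The transposition (i+1, i+2) of {1, ..., d}: 'I_d is numbered from 0.       *)
Definition adj_tperm (d : nat) (i : 'I_d.-1) : 'S_d :=
  tperm (Ordinal (ltnW (adj_ltn i))) (Ordinal (adj_ltn i)).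

Definition hurwitz (d g : nat) : Sigma d :=
  \prod_(i < d.-1)
     x_ (adj_tperm i) ^+ (if val i == 0%N then 2 * (g + 1) else 2)%N.

Definition stabilizing (d : nat) (h : Sigma d) : Prop :=
  forall s1 s2 : Sigma d, tau s1 = tau s2 -> alpha s1 = alpha s2 ->
    h * s1 = h * s2.

Definition stable (d : nat) : Prop := exists h : Sigma d, stabilizing h.

(* Main.v *)
Require Import Defs.
From mathcomp Require Import all_boot all_fingroup.
From mathcomp Require Import generic_quotient.
From mathcomp Require Import zify.

(* Elements of alpha-value 1 are central, and h = hurwitz d 0 satisfies        *)
(* h * x_t ^+ 2 = h * x_t' ^+ 2 for all transpositions t, t', because the      *)
(* squares of the adjacent transpositions divide h.  Clearing the points       *)
(* d - 1, d - 2, ... one after the other from a word w of transpositions       *)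
(* therefore shows that h * w depends only on the length and the product of w. *)
(* Since 2 [d/2] is even and at least d - 1, a word of that length can, in the *)
(* presence of h, be made to end with any given transposition t, and moving    *)
(* x_t across the next letter x_y conjugates y by t.  So every letter of s can *)
(* be replaced in h * w * s by a chosen representative of its conjugacy class; *)
(* the type of s determines these up to order, and alpha s the remaining word. *)

Set Implicit Arguments.
Unset Strict Implicit.
Unset Printing Implicit Defensive.

Local Open Scope group_scope.

(** Write h for [hurwitz d 0]. The core is [hurwitz0_tword_eq]: behind h, a factorization into
    transpositions is determined by its length and its product. Indeed the squares of all
    transpositions become interchangeable ([hurwitz0_tperm_sq]), and once such squares are split
    off, the image of each point dictates the letter that is left over for it ([hurwitz0_tword_nf]).

    The Hurwitz element of genus [d/2] is h times 2[d/2] >= d-1 copies of one transposition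
    ([hurwitz_recl]). This reservoir can be rewritten with any prescribed last letter, hence can
    conjugate the letter next to it by any permutation ([hurwitz0_tword_conj]). So elements of equal
    type become one common product of class representatives followed by h and reservoirs of equal
    length ([hurwitz0_tword_canonical]). Equality under [alpha] makes the products of the reservoirs
    agree, and the core lemma identifies them. *)

(** * Commutation rules and central elements *)

Lemma x_pass d (y : 'S_d) (s : Sigma d) : x_ y * s = s * x_ (y ^ alpha s).
Proof.
rewrite -[s]reprK -Sigma_prod; elim: (repr s) y => [|t w IHw] y.
  by rewrite big_nil gmulf1 conjg1 mulg1 mul1g.
by rewrite big_cons gmulfM /= alpha_x mulgA Sigma_conjr -!mulgA IHw conjgM -conjgE.
Qed.

Lemma x_exp_pass d (y : 'S_d) (s : Sigma d) n :
  x_ y ^+ n * s = s * x_ (y ^ alpha s) ^+ n.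
Proof.
elim: n => [|n IHn]; first by rewrite !expg0 mulg1 mul1g.
by rewrite !expgSr -mulgA x_pass !mulgA IHn.
Qed.

Lemma alpha1_central d (s a : Sigma d) : alpha s = 1 -> a * s = s * a.
Proof.
move=> s1; rewrite -[a]reprK -Sigma_prod.
elim: (repr a) => [|y w IHw]; first by rewrite big_nil mul1g mulg1.
by rewrite big_cons -mulgA IHw mulgA (x_pass y s) s1 conjg1 mulgA.
Qed.

Lemma alpha_x_tperm_sq d (a b : 'I_d) : alpha (x_ (tperm a b) ^+ 2) = 1.
Proof. by rewrite gmulfXn /= alpha_x expg2 tperm2. Qed.

(** * Words of transpositions *)

Definition tword d (w : seq ('I_d * 'I_d)) : Sigma d :=
  \prod_(p <- w) x_ (tperm p.1 p.2).

Definition tprod d (w : seq ('I_d * 'I_d)) : 'S_d :=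
  \prod_(p <- w) tperm p.1 p.2.

Lemma alpha_tword d (w : seq ('I_d * 'I_d)) : alpha (tword w) = tprod w.
Proof. by rewrite gmulf_prod; apply: eq_bigr => p _; exact: alpha_x. Qed.

Lemma tword_rcons d (w : seq ('I_d * 'I_d)) p :
  tword (rcons w p) = tword w * x_ (tperm p.1 p.2).
Proof. by rewrite /tword -cats1 big_cat big_seq1. Qed.

Lemma tprod_rcons d (w : seq ('I_d * 'I_d)) p :
  tprod (rcons w p) = tprod w * tperm p.1 p.2.
Proof. by rewrite /tprod -cats1 big_cat big_seq1. Qed.

Lemma tword_cat d (u v : seq ('I_d * 'I_d)) : tword (u ++ v) = tword u * tword v.
Proof. by rewrite /tword big_cat. Qed.

Lemma tword_nseq d n (p : 'I_d * 'I_d) :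
  tword (nseq n p) = x_ (tperm p.1 p.2) ^+ n.
Proof.
elim: n => [|n IHn]; first by rewrite /tword big_nil.
by rewrite expgS -IHn /tword big_cons.
Qed.

(** * Squares of transpositions behind the Hurwitz element *)

Lemma hurwitz_recl n g :
  hurwitz n.+2 g = x_ (adj_tperm (ord0 : 'I_n.+2.-1)) ^+ (2 * g) * hurwitz n.+2 0.
Proof.
rewrite /hurwitz !big_ord_recl /= mulgA; congr (_ * _).
by rewrite -expgnDr; congr (_ ^+ _); lia.
Qed.

Lemma alpha_hurwitz d g : alpha (hurwitz d g) = 1.
Proof.
rewrite gmulf_prod big1 // => i _; rewrite /adj_tperm.
case: ifP => _; last exact: alpha_x_tperm_sq.
by rewrite expgnA gmulfXn /= alpha_x_tperm_sq expg1n.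
Qed.

Lemma hurwitz_central d g (a : Sigma d) : a * hurwitz d g = hurwitz d g * a.
Proof. exact/alpha1_central/alpha_hurwitz. Qed.

(** Let t be the adjacent transposition and X the square on the left. As X is central and x_t^2
    divides h, x_t x_t X = x_t X x_t, and moving X back to the right across x_t conjugates it by
    t. *)
Lemma hurwitz0_conj_adj d (a b : 'I_d) (i : 'I_d.-1) :
  hurwitz d 0 * x_ (tperm a b) ^+ 2
  = hurwitz d 0 * x_ (tperm a b ^ adj_tperm i) ^+ 2.
Proof.
have [r1 [r2 ->]] : exists r1 r2, hurwitz d 0 = r1 * x_ (adj_tperm i) ^+ 2 * r2.
  rewrite /hurwitz; case/splitPr: (mem_index_enum i) => p1 p2.
  by rewrite big_cat big_cons /= mulgA; case: ifP => _; eexists; eexists.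
have cJ : alpha (x_ (tperm a b ^ adj_tperm i) ^+ 2) = 1.
  by rewrite tpermJ alpha_x_tperm_sq.
have e : x_ (adj_tperm i) ^+ 2 * x_ (tperm a b) ^+ 2
       = x_ (adj_tperm i) ^+ 2 * x_ (tperm a b ^ adj_tperm i) ^+ 2.
  rewrite [x_ (adj_tperm i) ^+ 2]expg2 -!mulgA (alpha1_central _ (alpha_x_tperm_sq a b)).
  by rewrite x_exp_pass alpha_x.
rewrite -[LHS]mulgA -[RHS]mulgA (alpha1_central r2 cJ).
rewrite (alpha1_central r2 (alpha_x_tperm_sq a b)) [LHS]mulgA [RHS]mulgA.
by congr (_ * r2); rewrite -(mulgA r1 _ (_ ^+ 2)) e (mulgA r1).
Qed.

(** The g that work for all a, b are closed under products and include the adjacent transpositions,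
    which generate the symmetric group. *)
Lemma hurwitz0_conj n (a b : 'I_n.+2) (g : 'S_n.+2) :
  hurwitz n.+2 0 * x_ (tperm a b) ^+ 2
  = hurwitz n.+2 0 * x_ (tperm a b ^ g) ^+ 2.
Proof.
pose inv (g : 'S_n.+2) := forall a b,
  hurwitz n.+2 0 * x_ (tperm a b) ^+ 2
  = hurwitz n.+2 0 * x_ (tperm a b ^ g) ^+ 2.
have invM g1 g2 : inv g1 -> inv g2 -> inv (g1 * g2).
  by move=> i1 i2 {}a {}b; rewrite i1 tpermJ i2 -tpermJ conjgM.
have inv1 : inv 1 by move=> {}a {}b; rewrite conjg1.
have inv0 k (lt_k : k < n.+2) : inv (tperm ord0 (Ordinal lt_k)).
  elim: k lt_k => [|k IHk] lt_k.
    by rewrite (_ : Ordinal lt_k = ord0) ?tperm1 //; apply: val_inj.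
  have lt_k' : k < n.+2.-1 by [].
  have invk : inv (adj_tperm (Ordinal lt_k')).
    by move=> {}a {}b; exact: hurwitz0_conj_adj.
  case: k IHk lt_k lt_k' invk => [|k] IHk lt_k lt_k' invk.
    rewrite (_ : tperm _ _ = adj_tperm (Ordinal lt_k')) //.
    by congr tperm; apply: val_inj.
  (* (0 k+2) is the conjugate of (0 k+1) by (k+1 k+2). *)
  rewrite (_ : tperm _ _ = tperm ord0 (Ordinal (ltnW lt_k)) ^ adj_tperm (Ordinal lt_k')).
    by rewrite conjgE tpermV; exact: (invM _ _ invk (invM _ _ (IHk _) invk)).
  rewrite tpermJ; congr tperm; first by rewrite tpermD.
  rewrite /adj_tperm (_ : Ordinal (ltnW lt_k) = Ordinal (ltnW (adj_ltn (Ordinal lt_k')))).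
    by rewrite tpermL; apply: val_inj.
  exact: val_inj.
have invT c e : inv (tperm c e).
  have [<-|ne] := eqVneq c e; first by rewrite tperm1.
  have [->|c0] := eqVneq c ord0; first by case: e {ne}.
  have [->|e0] := eqVneq e ord0; first by rewrite tpermC; case: c {ne c0}.
  rewrite (_ : tperm c e = tperm ord0 e ^ tperm ord0 c).
    rewrite conjgE tpermV; case: c {ne c0} => k1 l1; case: e {e0} => k2 l2.
    by apply: (invM) => //; apply: (invM).
  by rewrite tpermJ_tperm // eq_sym.
have [ts -> _] := prod_tpermP g.
suff : inv (\prod_(t <- ts) tperm t.1 t.2) by exact.
elim: ts => [|t ts IHts]; first by rewrite big_nil.
by rewrite big_cons; apply: (invM).
Qed.

Lemma tperm_conj_tperm d (a b c e : 'I_d) :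
  a != b -> c != e -> exists g, tperm c e = tperm a b ^ g.
Proof.
(* The first factor sends a to c; the second sends the image of b to e and fixes c. *)
move=> ab ce; exists (tperm a c * tperm (tperm a c b) e).
rewrite tpermJ !permM tpermL tpermL tpermD //; last by rewrite eq_sym.
by rewrite -{2}(tpermL a c) (inj_eq perm_inj) eq_sym.
Qed.

Lemma hurwitz0_tperm_sq n (a b c e : 'I_n.+2) : a != b -> c != e ->
  hurwitz n.+2 0 * x_ (tperm a b) ^+ 2 = hurwitz n.+2 0 * x_ (tperm c e) ^+ 2.
Proof.
by move=> ab ce; have [g ->] := tperm_conj_tperm ab ce; exact: hurwitz0_conj.
Qed.

Lemma hurwitz0_tperm_even n (a b c e : 'I_n.+2) q : a != b -> c != e ->
  hurwitz n.+2 0 * x_ (tperm a b) ^+ (2 * q)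
  = hurwitz n.+2 0 * x_ (tperm c e) ^+ (2 * q).
Proof.
move=> ab ce; rewrite !expgnA.
move: (hurwitz0_tperm_sq ab ce) (alpha_x_tperm_sq c e).
move: (x_ (tperm a b) ^+ 2) (x_ (tperm c e) ^+ 2) => X Y eXY cY.
elim: q => [|q IHq] //.
have cYq : alpha (Y ^+ q) = 1 by rewrite gmulfXn /= cY expg1n.
by rewrite expgSr mulgA IHq -mulgA -(alpha1_central X cYq) mulgA eXY expgS mulgA.
Qed.

(** * Normal form of a word of transpositions, clearing one point at a time *)

Definition supp_lt d m (w : seq ('I_d * 'I_d)) :=
  all [pred p | (val p.1 < m) && (val p.2 < m)] w.

(** The bound on [i] is guarded because no point lies below [m] when [m] is 0; then only r = 0
    occurs. *)
Definition star_split d (m : 'I_d) (s : Sigma d) (n : nat) : Prop :=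
  exists (w : seq ('I_d * 'I_d)) (i : 'I_d) (r : nat),
    [/\ all dpair w, supp_lt m w, 0 < r -> i < m,
        s = tword w * x_ (tperm m i) ^+ r & n = size w + r].

(* Letters are absorbed one at a time into the form [w x_(m i)^r]: a letter    *)
(* avoiding [m] is moved to the left of the power, and for [j != i]            *)
(* [x_(m i)^r x_(m j) = x_(m j) x_(i j)^r = x_(i j)^r x_(m k)].                *)
Lemma tword_star_split d (m : 'I_d) (w : seq ('I_d * 'I_d)) :
  all dpair w -> supp_lt m.+1 w -> star_split m (tword w) (size w).
Proof.
elim/last_ind: w => [|w p IHw].
  by exists [::], m, 0%N; split; rewrite // /tword big_nil mulg1.
rewrite /supp_lt !all_rcons /= => /andP[dp dw] /andP[/andP[lp1 lp2] lw].
have {IHw} [w' [i [r [dw' lw' li ew sw]]]] := IHw dw lw.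
rewrite tword_rcons size_rcons.
have neqm (j : 'I_d) : j < m -> j != m by move=> ?; rewrite -val_eqE neq_ltn; apply/orP; left.
have avoid (j k : 'I_d) : j != k -> j < m -> k < m ->
    star_split m (tword w * x_ (tperm j k)) (size w).+1.
  move=> jk lj lk; exists (rcons w' (j, k)), (tperm j k i), r.
  rewrite /supp_lt !all_rcons /= jk lj lk; split=> //.
  - move=> /li lim; case: tpermP => //.
  - rewrite tword_rcons ew -!mulgA x_exp_pass alpha_x tpermJ.
    by rewrite [tperm j k m]tpermD // neqm.
  - by rewrite size_rcons sw addSn.
have star (j : 'I_d) : j < m ->
    star_split m (tword w * x_ (tperm m j)) (size w).+1.
  move=> lj; have [r0|r_gt0] := posnP r.
    by exists w', j, 1%N; split; rewrite // ?ew ?sw r0 ?mulg1 // addn1 addn0.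
  have [eij|nij] := eqVneq i j.
    exists w', j, r.+1; split; rewrite // ?addnS ?sw //.
    by rewrite ew eij expgSr mulgA.
  have lim := li r_gt0.
  have mj : m != j by rewrite eq_sym neqm.
  have mi : m != i by rewrite eq_sym neqm.
  (* (i j)^r depends only on the parity of r, and so does the conjugate of (m j) by it. *)
  pose k := if odd r then i else j.
  have kP : tperm m j ^ (tperm i j ^+ r) = tperm m k.
    rewrite /k -[r]odd_double_half -muln2 mulnC expgnDr expgnA expg2 tperm2 expg1n.
    rewrite mulg1 oddD mul2n odd_double addbF oddb.
    case: (odd r); rewrite ?expg1 ?conjg1 // tpermJ tpermR.
    by rewrite tpermD // eq_sym.
  exists (w' ++ nseq r (i, j)), k, 1%N; split.
  - by rewrite all_cat dw' all_nseq /= nij orbT.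
  - by rewrite /supp_lt all_cat all_nseq /= lim lj orbT andbT.
  - by rewrite /k; case: ifP.
  - rewrite expg1 tword_cat tword_nseq /= -mulgA -kP.
    have -> : tperm i j ^+ r = alpha (x_ (tperm i j) ^+ r).
      by rewrite gmulfXn /= alpha_x.
    rewrite -x_pass ew -mulgA x_exp_pass alpha_x tpermJ tpermL.
    by rewrite [tperm m j i]tpermD // 1?eq_sym // [tperm j i]tpermC.
  - by rewrite size_cat size_nseq sw addn1.
case: p dp lp1 lp2 => j k /= jk lj lk.
have [ejm|njm] := eqVneq j m; last have [ekm|nkm] := eqVneq k m.
- by rewrite ejm; apply: star; move: jk; rewrite -val_eqE ejm /= => *; lia.
- by rewrite ekm tpermC; apply: star; move: njm; rewrite -val_eqE /= => *; lia.
- by apply: avoid => //; move: njm nkm; rewrite -!val_eqE /= => *; lia.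
Qed.

Lemma tprod_fix d m (w : seq ('I_d * 'I_d)) (x : 'I_d) :
  supp_lt m w -> m <= x -> tprod w x = x.
Proof.
move=> lw mx; elim: w lw => [|p w IHw] /=; first by rewrite /tprod big_nil perm1.
move=> /andP[/andP[l1 l2] lw]; rewrite /tprod big_cons permM tpermD ?IHw //.
- by rewrite -val_eqE neq_ltn (leq_trans l1 mx).
- by rewrite -val_eqE neq_ltn (leq_trans l2 mx).
Qed.

(** In the power of (m i) produced by [tword_star_split], the even part is central and can be
    traded, behind h, for the same power of the reference transposition [t]. At most one letter
    moving [m] survives. *)
Lemma hurwitz0_tword_star n (t : 'I_n.+2 * 'I_n.+2) (m : 'I_n.+2) w :
  dpair t -> all dpair w -> supp_lt m.+1 w ->
  exists w' (i : 'I_n.+2) (q : nat) (e : bool),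
    [/\ all dpair w', supp_lt m w', e -> i < m, size w = size w' + 2 * q + e
      & hurwitz n.+2 0 * tword w
        = hurwitz n.+2 0 * x_ (tperm t.1 t.2) ^+ (2 * q)
          * (tword w' * x_ (tperm m i) ^+ e)]
      /\ tprod w = tprod w' * tperm m i ^+ e.
Proof.
move=> dt dw lw; have [w' [i [r [dw' lw' lim ew sw]]]] := tword_star_split dw lw.
exists w', i, r./2, (odd r).
have er : r = (2 * r./2 + odd r)%N by lia.
have cA q : alpha (x_ (tperm m i) ^+ (2 * q)) = 1.
  by rewrite expgnA gmulfXn /= alpha_x_tperm_sq expg1n.
split; last first.
  rewrite -!alpha_tword ew {1}er expgnDr !gmulfM /=; congr (_ * _).
  by rewrite cA mul1g gmulfXn /= alpha_x.
split=> //; first by case: (r) lim => // r' /(_ isT).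
- by rewrite sw -addnA -er.
- rewrite ew {1}er expgnDr [tword w' * (_ * _)]mulgA (alpha1_central (tword w') (cA _)).
  rewrite -[_ * tword w' * _]mulgA [LHS]mulgA; congr (_ * _).
  have [r2|r2] := posnP r./2; first by rewrite r2 muln0.
  apply: hurwitz0_tperm_even => //.
  by rewrite -val_eqE neq_ltn lim ?orbT //; lia.
Qed.

(** Induction on the number of points still to be cleared. The two words may differ in length, so
    only the exponents of [t] differ; [c] is the length of the common remainder [C]. *)
Lemma hurwitz0_tword_nf n (t : 'I_n.+2 * 'I_n.+2) m w1 w2 :
  dpair t -> m <= n.+2 -> all dpair w1 -> all dpair w2 ->
  supp_lt m w1 -> supp_lt m w2 -> tprod w1 = tprod w2 ->
  exists (q1 q2 c : nat) (C : Sigma n.+2),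
    [/\ size w1 = c + 2 * q1, size w2 = c + 2 * q2,
        hurwitz n.+2 0 * tword w1
        = hurwitz n.+2 0 * x_ (tperm t.1 t.2) ^+ (2 * q1) * C
      & hurwitz n.+2 0 * tword w2
        = hurwitz n.+2 0 * x_ (tperm t.1 t.2) ^+ (2 * q2) * C].
Proof.
move=> dt; elim: m w1 w2 => [|m IHm] w1 w2 lm dw1 dw2 lw1 lw2 ew.
  case: w1 {dw1 ew} lw1 => //; case: w2 {dw2} lw2 => // _ _.
  by exists 0%N, 0%N, 0%N, 1; rewrite /tword big_nil !mulg1.
have [u1 [i1 [q1 [e1 [[du1 lu1 li1 s1 h1] a1]]]]] :=
  hurwitz0_tword_star (m := Ordinal lm) dt dw1 lw1.
have [u2 [i2 [q2 [e2 [[du2 lu2 li2 s2 h2] a2]]]]] :=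
  hurwitz0_tword_star (m := Ordinal lm) dt dw2 lw2.
(* The cleared words fix the top point, so its image under the common product reveals whether a last
   letter is present and which one it is. *)
have [ee ei] : e1 = e2 /\ (e1 -> i1 = i2).
  have : tprod w1 (Ordinal lm) = tprod w2 (Ordinal lm) by rewrite ew.
  rewrite a1 a2 !permM !(@tprod_fix _ m) //.
  case: e1 e2 li1 li2 {s1 h1 a1 s2 h2 a2} => [] [] l1 l2;
    rewrite ?expg1 ?expg0 ?perm1 ?tpermL //.
  - by move=> E; move: (l1 isT); rewrite E /= ltnn.
  - by move=> E; move: (l2 isT); rewrite -E /= ltnn.
subst e2.
have eL : tperm (Ordinal lm) i1 ^+ e1 = tperm (Ordinal lm) i2 ^+ e1.
  by case: e1 ei {li1 li2 s1 h1 a1 s2 h2 a2} => // ->.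
have eX : x_ (tperm (Ordinal lm) i1) ^+ e1 = x_ (tperm (Ordinal lm) i2) ^+ e1.
  by case: e1 ei {li1 li2 s1 h1 a1 s2 h2 a2 eL} => // ->.
have eu : tprod u1 = tprod u2.
  by move: ew; rewrite a1 a2 eL => /mulIg.
have [p1 [p2 [c [C [t1 t2 g1 g2]]]]] := IHm u1 u2 (ltnW lm) du1 du2 lu1 lu2 eu.
exists (q1 + p1)%N, (q2 + p2)%N, (c + e1)%N, (C * x_ (tperm (Ordinal lm) i2) ^+ e1).
have glue q p u : hurwitz n.+2 0 * tword u
      = hurwitz n.+2 0 * x_ (tperm t.1 t.2) ^+ (2 * p) * C ->
    hurwitz n.+2 0 * x_ (tperm t.1 t.2) ^+ (2 * q)
      * (tword u * x_ (tperm (Ordinal lm) i2) ^+ e1)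
    = hurwitz n.+2 0 * x_ (tperm t.1 t.2) ^+ (2 * (q + p))
      * (C * x_ (tperm (Ordinal lm) i2) ^+ e1).
  move=> E; rewrite mulnDr (expgnDr _ (2 * q) (2 * p)) [LHS]mulgA [RHS]mulgA; congr (_ * _).
  rewrite -[in LHS](hurwitz_central 0 (_ ^+ (2 * q))) -[LHS]mulgA E.
  by rewrite !mulgA hurwitz_central.
split; [lia | lia | by rewrite h1 eX; apply: glue | by rewrite h2; apply: glue].
Qed.

Lemma hurwitz0_tword_eq n (w1 w2 : seq ('I_n.+2 * 'I_n.+2)) :
  all dpair w1 -> all dpair w2 -> size w1 = size w2 -> tprod w1 = tprod w2 ->
  hurwitz n.+2 0 * tword w1 = hurwitz n.+2 0 * tword w2.
Proof.
move=> d1 d2 es ep.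
have supp (w : seq ('I_n.+2 * 'I_n.+2)) : supp_lt n.+2 w by apply/allP => p _; apply/andP; split; exact: ltn_ord.
have dt : dpair (ord0 : 'I_n.+2, ord_max : 'I_n.+2) by [].
have [q1 [q2 [c [C [s1 s2 -> ->]]]]] :=
  hurwitz0_tword_nf dt (leqnn _) d1 d2 (supp _) (supp _) ep.
by have -> : q1 = q2 by move: es; rewrite s1 s2; lia.
Qed.

(** * Factorizations of prescribed length *)

Lemma perm_tprod_short d m (g : 'S_d) : m <= d -> (forall x : 'I_d, m <= x -> g x = x) ->
  exists w, [/\ all dpair w, size w <= m.-1 & tprod w = g].
Proof.
elim: m g => [|m IHm] g lm fixg.
  by exists [::]; split; rewrite // /tprod big_nil; apply/permP => x; rewrite perm1 fixg.
pose mo := Ordinal lm; have [gm|gm] := eqVneq (g mo) mo.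
  have [x mx|w [dw sw ew]] := IHm g (ltnW lm); last first.
    by exists w; split=> //; rewrite (leq_trans sw) //= leq_pred.
  move: mx; rewrite leq_eqVlt => /orP[/eqP E|]; last exact: fixg.
  by rewrite (_ : x = mo) //; apply: val_inj.
have lgm : g mo < m.
  rewrite ltn_neqAle -val_eqE in gm *; rewrite gm /= leqNgt; apply/negP => l.
  by have := fixg _ l => /perm_inj E; move: gm; rewrite E eqxx.
have [x mx|w [dw sw ew]] := IHm (g * tperm mo (g mo)) (ltnW lm).
- rewrite permM; move: mx; rewrite leq_eqVlt => /orP[/eqP E|mx].
    by rewrite (_ : x = mo) ?tpermR //; apply: val_inj.
  rewrite (fixg x mx) tpermD // -val_eqE neq_ltn /= ?mx //.
  by rewrite (ltn_trans lgm mx).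
exists (rcons w (mo, g mo)); split.
- by rewrite all_rcons dw andbT /= eq_sym.
- by rewrite size_rcons /=; case: (m) lgm sw => // k _; rewrite /= ltnS.
- by rewrite tprod_rcons ew -mulgA tperm2 mulg1.
Qed.

Lemma perm_tprod_size n (g : 'S_n.+2) k : n <= k -> odd k = odd_perm g ->
  exists w, [/\ all dpair w, size w = k & tprod w = g].
Proof.
move=> nk ok; have [x|w [dw sw ew]] := perm_tprod_short (g := g) (leqnn n.+2).
  by rewrite leqNgt ltn_ord.
have ow : odd (size w) = odd k by rewrite ok -ew odd_perm_prod.
(* The word has at most n+1 letters, so it could exceed [k] only if k = n, by one letter, which
   parity excludes. *)
have le_wk : size w <= k by move: ow sw => /=; lia.
exists (w ++ nseq (k - size w) (ord0, ord_max)); split.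
- by rewrite all_cat dw all_nseq /= orbT.
- by rewrite size_cat size_nseq subnKC.
- have od : odd (k - size w) = false by rewrite oddB // ow addbb.
  rewrite /tprod big_cat /= -/(tprod w) ew -[k - size w]odd_double_half od.
  rewrite add0n; elim: _./2 => [|q IHq]; first by rewrite big_nil mulg1.
  by rewrite doubleS /= !big_cons (mulgA (tperm _ _)) tperm2 mul1g.
Qed.

(** * Conjugating letters by means of the reservoir *)

Lemma hurwitz0_tword_conj_tperm n k (w : seq ('I_n.+2 * 'I_n.+2)) y a b :
  n < k -> ~~ odd k -> all dpair w -> size w = k -> a != b ->
  exists w', [/\ all dpair w', size w' = k
    & hurwitz n.+2 0 * tword w * x_ y
      = hurwitz n.+2 0 * tword w' * x_ (y ^ tperm a b)].
Proof.
case: k => // k nk ok dw sw ab.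
have [|w' [dw' sw' ew']] := perm_tprod_size (g := tprod w * tperm a b) nk.
  rewrite odd_permM odd_perm_prod // odd_tperm ab sw /=.
  by move: ok => /=; rewrite negbK => ->.
have ew : hurwitz n.+2 0 * tword w = hurwitz n.+2 0 * tword (rcons w' (a, b)).
  apply: hurwitz0_tword_eq => //.
  - by rewrite all_rcons dw' andbT.
  - by rewrite size_rcons sw' sw.
  - by rewrite tprod_rcons ew' -mulgA tperm2 mulg1.
set y' := y ^ tperm a b.
(* With t = (a b), x_t x_y = x_y' x_t; pulling x_t back to the left of x_y' turns it into the
   transposition of the preimages of a and b under y'. *)
exists (rcons w' (y'^-1 a, y'^-1 b)); split.
- by rewrite all_rcons dw' andbT /= (inj_eq perm_inj).
- by rewrite size_rcons sw'.
rewrite ew !tword_rcons /= -!mulgA; congr (_ * (_ * _)).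
rewrite -tpermJ conjgE invgK mulgA -[RHS]Sigma_conjl [LHS]Sigma_conjl.
congr (x_ _ * _).
by rewrite /y' conjgE tpermV mulgA.
Qed.

Lemma hurwitz0_tword_conj n k (w : seq ('I_n.+2 * 'I_n.+2)) y g :
  n < k -> ~~ odd k -> all dpair w -> size w = k ->
  exists w', [/\ all dpair w', size w' = k
    & hurwitz n.+2 0 * tword w * x_ y = hurwitz n.+2 0 * tword w' * x_ (y ^ g)].
Proof.
move=> nk ok; have [ts -> dts] := prod_tpermP g.
elim: ts dts w y => [|[a b] ts IHts] /= dts w y dw sw.
  by exists w; split=> //; rewrite big_nil conjg1.
have /andP[ab dts'] := dts.
have [w1 [dw1 sw1 ->]] := hurwitz0_tword_conj_tperm y nk ok dw sw ab.
have [w2 [dw2 sw2 ->]] := IHts dts' w1 (y ^ tperm a b) dw1 sw1.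
by exists w2; split=> //; rewrite big_cons conjgM.
Qed.

(** * Replacing letters by class representatives *)

Lemma pi_pass d (u : seq 'S_d) y :
  \pi_(Sigma d)%qT u * x_ y = x_ y * \pi_(Sigma d)%qT [seq z ^ y | z <- u].
Proof.
rewrite -!Sigma_prod; elim: u => [|z u IHu] /=; first by rewrite !big_nil mulg1 mul1g.
by rewrite !big_cons -mulgA IHu !mulgA x_pass alpha_x.
Qed.

Lemma tword_pass d (w : seq ('I_d * 'I_d)) (y : 'S_d) :
  tword w * x_ y = x_ y * tword [seq (y p.1, y p.2) | p <- w].
Proof.
rewrite /tword; elim: w => [|p w IHw] /=; first by rewrite !big_nil mulg1 mul1g.
by rewrite !big_cons -mulgA IHw !mulgA x_pass alpha_x tpermJ.
Qed.

Definition class_rep d (y : 'S_d) : 'S_d := fingroup.repr (y ^: [set: 'S_d]).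

Lemma class_repP d (y : 'S_d) : exists g, class_rep y = y ^ g.
Proof.
have /imsetP[g _ e] := mem_repr y (class_refl [set: 'S_d] y).
by exists g.
Qed.

Lemma class_rep_eq d (y z : 'S_d) :
  (class_rep y == class_rep z) = (y \in z ^: [set: 'S_d]).
Proof.
apply/eqP/class_eqP => [e|]; last by rewrite /class_rep => ->.
have [g yg] := class_repP y; have [h zh] := class_repP z.
have <- : (y ^ g) ^: [set: 'S_d] = y ^: [set: 'S_d] by rewrite classGidl ?inE.
by rewrite -yg e zh classGidl ?inE.
Qed.

Lemma class_repJ d (y g : 'S_d) : class_rep (y ^ g) = class_rep y.
Proof. by rewrite /class_rep classGidl ?inE. Qed.

(** For each entry c of [v], bring a letter of [u] from its class to the front of [u], make it c
    with the reservoir, and carry it to the far left. The letters it crosses are only conjugated, so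
    classes and the length of the reservoir are preserved. *)
Lemma hurwitz0_tword_canonical n k (v u : seq 'S_n.+2) w :
  n < k -> ~~ odd k -> all dpair w -> size w = k ->
  perm_eq v (map (@class_rep n.+2) u) ->
  exists w', [/\ all dpair w', size w' = k
    & hurwitz n.+2 0 * tword w * \pi_(Sigma n.+2)%qT u
      = \pi_(Sigma n.+2)%qT v * (hurwitz n.+2 0 * tword w')].
Proof.
move=> nk ok; elim: v u w => [|c v IHv] u w dw sw puv.
  have u0 : u = [::] by move: (perm_size puv); rewrite size_map; case: (u).
  exists w; split=> //; rewrite u0 -[\pi_(Sigma n.+2)%qT [::]]/(1 : Sigma n.+2).
  by rewrite mulg1 mul1g.
have : c \in map (@class_rep n.+2) u by rewrite -(perm_mem puv) mem_head.
case/mapP => y yu cy; case/splitPr: yu puv => a b puv.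
have [g yg] := class_repP y.
have [w1 [dw1 sw1 e1]] := hurwitz0_tword_conj y g nk ok dw sw.
pose w2 := [seq (c p.1, c p.2) | p <- w1].
have dw2 : all dpair w2.
  by rewrite all_map; apply: sub_all dw1 => p /=; rewrite (inj_eq perm_inj).
have [||w3 [dw3 sw3 e3]] := IHv ([seq z ^ y | z <- a] ++ b) w2 dw2.
- by rewrite size_map.
- move: puv; rewrite cy !map_cat /= -map_comp.
  rewrite (eq_map (g := @class_rep n.+2)); last by move=> z /=; rewrite class_repJ.
  by rewrite perm_sym perm_catC /= perm_cons perm_catC perm_sym.
exists w3; split=> //.
have -> : \pi_(Sigma n.+2)%qT (a ++ y :: b)
        = x_ y * \pi_(Sigma n.+2)%qT ([seq z ^ y | z <- a] ++ b).
  by rewrite -Sigma_prod big_cat big_cons !Sigma_prod /= mulgA pi_pass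
             -(Sigma_mulE _ b) -mulgA.
have -> : \pi_(Sigma n.+2)%qT (c :: v) = x_ c * \pi_(Sigma n.+2)%qT v.
  by rewrite -Sigma_prod big_cons Sigma_prod.
rewrite -(mulgA (x_ c)) -e3 !mulgA e1 -yg -cy; congr (_ * _).
by rewrite -[LHS]mulgA tword_pass [LHS]mulgA hurwitz_central.
Qed.

(** * The stabilizing property *)

Lemma hurwitz_stabilizing n : stabilizing (hurwitz n.+2 (n.+2 %/ 2)).
Proof.
move=> s1 s2 etau ealpha.
(* Identity letters are invisible to [tau], so they are removed before letters are counted by
   class. *)
pose nt (s : Sigma n.+2) := [seq y <- generic_quotient.repr s | y != 1].
have ntE s : \pi_(Sigma n.+2)%qT (nt s) = s.
  rewrite -[RHS]reprK /nt -!Sigma_prod big_filter.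
  elim: (generic_quotient.repr s) => [|y u IHu]; first by rewrite !big_nil.
  rewrite !big_cons IHu; case: eqP => //= ->; by rewrite x_1 mul1g.
set k := (2 * (n.+2 %/ 2))%N.
have nk : n < k by rewrite /k; lia.
have ok : ~~ odd k by rewrite /k mul2n odd_double.
pose t0 : 'I_n.+2 * 'I_n.+2 :=
  (Ordinal (ltnW (adj_ltn (ord0 : 'I_n.+2.-1))), Ordinal (adj_ltn (ord0 : 'I_n.+2.-1))).
have hE : hurwitz n.+2 (n.+2 %/ 2) = hurwitz n.+2 0 * tword (nseq k t0).
  by rewrite hurwitz_recl tword_nseq hurwitz_central.
have dw0 : all dpair (nseq k t0) by rewrite all_nseq orbT.
have [w1 [dw1 sw1 e1]] :=
  hurwitz0_tword_canonical nk ok dw0 (size_nseq _ _) (perm_refl (map (@class_rep _) (nt s1))).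
have [|w2 [dw2 sw2 e2]] := hurwitz0_tword_canonical
  (v := map (@class_rep _) (nt s1)) (u := nt s2) nk ok dw0 (size_nseq _ _).
  (* The multiplicity of a class representative is the value of [tau] at its class. *)
  apply/allP => c; rewrite -map_cat => /mapP[y0 yin ->] /=.
  have y0n1 : y0 != 1.
    by move: yin; rewrite mem_cat !mem_filter => /orP[] /andP[].
  have Cin : y0 ^: [set: 'S_n.+2] \in classes [set: 'S_n.+2] :\ [set 1].
    rewrite !inE mem_classes ?inE // andbT; apply: contra y0n1 => /eqP E.
    by have := class_refl [set: 'S_n.+2] y0; rewrite E inE.
  pose C : nonid_class n.+2 := Sub (y0 ^: [set: _]) Cin.
  have cE s : count_mem (class_rep y0) (map (@class_rep _) (nt s)) = tau s C.
    rewrite -[in RHS](ntE s) tau_pi count_map; apply: eq_count => y /=.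
    exact: class_rep_eq.
  by rewrite !cE etau.
rewrite !ntE -!hE in e1 e2; rewrite e1 e2; congr (_ * _).
apply: hurwitz0_tword_eq; rewrite ?sw1 ?sw2 //.
have := congr1 (@alpha _) e1; have := congr1 (@alpha _) e2.
rewrite !gmulfM /= !alpha_hurwitz !mul1g !alpha_tword ealpha => -> /mulgI.
by [].
Qed.

Theorem corollary2p3 (d : nat) (hd : 2 <= d) :
  stabilizing (hurwitz d (d %/ 2)) /\ stable d.
Proof.
case: d hd => [|[|n]] // _; split; first exact: hurwitz_stabilizing.
by exists (hurwitz n.+2 (n.+2 %/ 2)); exact: hurwitz_stabilizing.
Qed.
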